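(* Let $L$ be a finite lattice and $K$ a field such that the join-meet ideal $I_L\subset K[L]$ is a radical ideal. Then $$I_L=\bigcap_{\substack{A\subset L\\ A\text{ admissible}}}P_A(L).$$
   Context: For a finite lattice $L$ and a field $K$, $K[L]$ is the polynomial ring over $K$ whose variables are the elements of $L$. A basic binomial is a binomial $ab-(a\wedge b)(a\vee b)$ with $a,b\in L$ incomparable; the join-meet ideal $I_L\subset K[L]$ is the ideal generated by all basic binomials. A subset $A\subset L$ is called admissible if for every basic binomial $ab-cd$ (so $a,b$ are incomparable, $c=a\wedge b$, $d=a\vee b$) one has: ($a\in A$ or $b\in A$) if and only if ($c\in A$ or $d\in A$). In particular $\emptyset$ and $L$ are admissible. For $A$ admissible, $L_A=L\setminus A$ is closed under the meet and join of $L$ and so is a sublattice (possibly empty), with join-meet ideal $I_{L_A}\subset K[L_A]=K[\{a: a\in L\setminus A\}]$ (zero if $L_A$ is empty). Set $$P_A(L)=\Big(I_{L_A}:\prod_{a\notin A}a\Big)+(a : a\in A)\subset K[L],$$ where the colon ideal is computed in $K[L_A]$ and then extended to $K[L]$ (an empty product is $1$). *)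

(* Defs.v *)
From HB Require Import structures.
From mathcomp Require Import all_boot all_order all_algebra.
From mathcomp Require Export mpoly.

Set Implicit Arguments.
Unset Strict Implicit.
Unset Printing Implicit Defensive.

Import Order.TTheory GRing.Theory.
Local Open Scope ring_scope.

(* Ideals, and arbitrary sets of generators, are Prop-valued predicates. *)
Section Ideals.
Variable R : comNzRingType.
Implicit Types (G I J : R -> Prop).

Definition ideal_gen G : R -> Prop := fun f =>
  exists s : seq (R * R),
    (forall p, p \in s -> G p.2) /\ f = \sum_(p <- s) p.1 * p.2.

Definition ideal_add I J : R -> Prop := fun f =>
  exists g h, [/\ I g, J h & f = g + h].

Definition ideal_colon I (u : R) : R -> Prop := fun f => I (f * u).

Definition radical I : R -> Prop := fun f => exists n : nat, I (f ^+ n).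

Definition radical_ideal I : Prop := forall f, radical I f <-> I f.

End Ideals.

Definition ideal_extension (R S : comNzRingType) (phi : R -> S)
    (I : R -> Prop) : S -> Prop :=
  ideal_gen (fun g => exists2 f, I f & g = phi f).

Definition lattice_poly (K : fieldType) d (L : finLatticeType d) :
  comNzRingType := {mpoly K[#|L|]}.

Section JoinMeetIdeal.
Variables (K : fieldType) (d : Order.disp_t) (L : finLatticeType d).

Definition lvar (a : L) : lattice_poly K L := 'X_(enum_rank a).

Definition basic_binomial (f : lattice_poly K L) : Prop :=
  exists a b : L, (a >< b)%O /\
    f = lvar a * lvar b - lvar (a `&` b)%O * lvar (a `|` b)%O.

Definition join_meet_ideal : lattice_poly K L -> Prop :=
  ideal_gen basic_binomial.

End JoinMeetIdeal.

Definition admissible d (L : finLatticeType d) (A : {set L}) : bool :=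
  [forall a : L, forall b : L, (a >< b)%O ==>
    (((a \in A) || (b \in A))
       == (((a `&` b)%O \in A) || ((a `|` b)%O \in A)))].

Section Complement.
Variables (d : Order.disp_t) (L : finLatticeType d) (A : {set L}).
Hypothesis admA : admissible A.

Definition admissible_compl of admissible A : {pred L} :=
  [pred a | a \notin A].

Lemma admissible_compl_meet :
  meet_closed (admissible_compl admA).
Proof.
move=> a b; rewrite !inE => aA bA.
case: (boolP (a >< b)%O) => [ab|].
  have /forallP/(_ a)/forallP/(_ b)/implyP/(_ ab)/eqP := admA.
  by rewrite (negbTE aA) (negbTE bA) => /esym/norP[].
by rewrite negbK => /orP[/meet_l|/meet_r] ->.
Qed.

Lemma admissible_compl_join :
  join_closed (admissible_compl admA).
Proof.
move=> a b; rewrite !inE => aA bA.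
case: (boolP (a >< b)%O) => [ab|].
  have /forallP/(_ a)/forallP/(_ b)/implyP/(_ ab)/eqP := admA.
  by rewrite (negbTE aA) (negbTE bA) => /esym/norP[].
by rewrite negbK => /orP[/join_r|/join_l] ->.
Qed.

HB.instance Definition _ := Order.isMeetLatticeClosed.Build d L
  (admissible_compl admA) admissible_compl_meet.
HB.instance Definition _ := Order.isJoinLatticeClosed.Build d L
  (admissible_compl admA) admissible_compl_join.

(* L_A, with the order, meet and join inherited from L; the type depends on the admissibility proof because
   that is what makes it closed under meet and join.  It may be empty. *)
Record compl_lattice : Type := ComplLattice {
  compl_val :> L;
  _ : compl_val \in admissible_compl admA
}.

HB.instance Definition _ := [isSub for compl_val].
HB.instance Definition _ := [Finite of compl_lattice by <:].
HB.instance Definition _ :=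
  [SubChoice_isSubLattice of compl_lattice by <: with d].

End Complement.

Section PA.
Variables (K : fieldType) (d : Order.disp_t) (L : finLatticeType d).
Variables (A : {set L}) (admA : admissible A).

(* The inclusion of K[L_A] in K[L]. *)
Definition compl_incl (f : lattice_poly K (compl_lattice admA)) :
    lattice_poly K L :=
  f \mPo [tuple lvar K (compl_val (enum_val i)) | i < #|{: compl_lattice admA}|].

Definition P_ideal : lattice_poly K L -> Prop :=
  ideal_add
    (ideal_extension compl_incl
       (ideal_colon (join_meet_ideal (K := K) (L := compl_lattice admA))
          (\prod_(a : compl_lattice admA) lvar K a)))
    (ideal_gen (fun g => exists2 a, a \in A & g = lvar K a)).

End PA.

(* Main.v *)
From HB Require Import structures.
Require Import Defs.
From mathcomp Require Import all_boot all_order all_algebra.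

(** Membership in [I_L] forces membership in each [P_A(L)] because each basic
    binomial lies there: by admissibility either both of its monomials are
    divisible by a variable of [A], or it is a basic binomial of the sublattice
    [L \ A].

    For the converse the textbook route takes a minimal prime [Q] of [I_L] and
    observes that the set [A] of variables in [Q] is admissible and that [Q]
    contains [P_A(L)]; as [I_L] is radical it is the intersection of its minimal
    primes.  The proof below unwinds this into a finite computation which
    involves no prime ideal.  Over any commutative ring
    [rad J] is the intersection of [rad (J + (x))] and [rad (J : x)]
    ([radical_split]).  Splitting in this way along each of the variables, the
    condition that [f] lies in [rad I_L] is reduced to one condition for every
    subset [A] of [L]: some power of [f * \prod_(a \notin A) a] lies in
    [I_L + (a : a \in A)] ([radical_split_vars]).

    If [A] is not admissible, some basic binomial has exactly one of its two
    monomials in [(a : a \in A)]; modulo [I_L + (a : a \in A)] the other one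
    vanishes, and it divides [\prod_(a \notin A) a]
    ([prod_compl_non_admissible]).  If [A] is admissible, the condition holds
    for every [f] in [P_A(L)], since [I_{L \ A}] is contained in [I_L]
    ([P_ideal_mul_prod]). *)

Set Implicit Arguments.
Unset Strict Implicit.
Unset Printing Implicit Defensive.

Import Order.TTheory GRing.Theory.
Local Open Scope ring_scope.

(** * Ideals as predicates *)

Section IdealTheory.
Variable R : comNzRingType.
Implicit Types (G I J : R -> Prop) (f g h u x : R).

Record is_ideal J : Prop := IsIdeal {
  ideal0 : J 0;
  idealD : forall f g, J f -> J g -> J (f + g);
  idealMl : forall u f, J f -> J (u * f)
}.

Lemma idealMr J u f : is_ideal J -> J f -> J (f * u).
Proof. by move=> idJ Jf; rewrite mulrC; apply: idealMl. Qed.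

Lemma idealN J f : is_ideal J -> J f -> J (- f).
Proof. by move=> idJ Jf; rewrite -mulN1r; apply: idealMl. Qed.

Lemma idealB J f g : is_ideal J -> J f -> J g -> J (f - g).
Proof. by move=> idJ Jf Jg; apply: idealD => //; apply: idealN. Qed.

Lemma ideal_gen_ideal G : is_ideal (ideal_gen G).
Proof.
split=> [|f g [s [Gs ->]] [t [Gt ->]]|u f [s [Gs ->]]].
- by exists [::]; rewrite big_nil.
- exists (s ++ t); rewrite big_cat; split=> // p.
  by rewrite mem_cat => /orP[/Gs|/Gt].
- exists [seq (u * p.1, p.2) | p <- s]; split=> [p /mapP[q /Gs Gq ->] //|].
  by rewrite big_map mulr_sumr; apply: eq_bigr => p _; rewrite mulrA.
Qed.

Lemma mem_ideal_gen G g : G g -> ideal_gen G g.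
Proof.
move=> Gg; exists [:: (1, g)]; rewrite big_seq1 mul1r.
by split=> // p; rewrite inE => /eqP->.
Qed.

Lemma ideal_gen_sub G J : is_ideal J ->
  (forall g, G g -> J g) -> forall f, ideal_gen G f -> J f.
Proof.
move=> idJ GJ f [s [Gs ->]]; rewrite big_seq.
apply: big_ind => [|g h Jg Jh|p /Gs/GJ Jp]; first exact: ideal0.
- exact: idealD.
- exact: idealMl.
Qed.

Lemma ideal_add_ideal I J :
  is_ideal I -> is_ideal J -> is_ideal (ideal_add I J).
Proof.
move=> idI idJ; split=> [|_ _ [a [b [Ia Jb ->]]] [c [e [Ic Je ->]]]|].
- by exists 0, 0; rewrite addr0; split=> //; apply: ideal0.
- by exists (a + c), (b + e); rewrite addrACA; split=> //; apply: idealD.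
- move=> u _ [a [b [Ia Jb ->]]].
  by exists (u * a), (u * b); rewrite mulrDr; split=> //; apply: idealMl.
Qed.

Lemma ideal_addl I J f : is_ideal J -> I f -> ideal_add I J f.
Proof. by move=> idJ If; exists f, 0; rewrite addr0; split=> //; apply: ideal0. Qed.

Lemma ideal_addr I J f : is_ideal I -> J f -> ideal_add I J f.
Proof. by move=> idI Jf; exists 0, f; rewrite add0r; split=> //; apply: ideal0. Qed.

Lemma ideal_add_sub I I' J : is_ideal J ->
  (forall g, I g -> J g) -> (forall g, I' g -> J g) ->
  forall f, ideal_add I I' f -> J f.
Proof.
move=> idJ sI sI' _ [g [h [/sI Jg /sI' Jh ->]]]; exact: idealD.
Qed.

Lemma ideal_colon_ideal J u : is_ideal J -> is_ideal (ideal_colon J u).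
Proof.
rewrite /ideal_colon => idJ; split=> [|f g Jf Jg|v f Jf].
- by rewrite mul0r; apply: ideal0.
- by rewrite mulrDl; apply: idealD.
- by rewrite -mulrA; apply: idealMl.
Qed.

Lemma mem_radical J f : J f -> radical J f.
Proof. by move=> Jf; exists 1%N; rewrite expr1. Qed.

Lemma radicalMr J u f : is_ideal J -> radical J f -> radical J (f * u).
Proof. by move=> idJ [n Jf]; exists n; rewrite exprMn; apply: idealMr. Qed.

Lemma radical_sub I J f : (forall g, I g -> J g) -> radical I f -> radical J f.
Proof. by move=> IJ [n If]; exists n; apply: IJ. Qed.

(** Prime by prime: a prime containing [J] either contains [x], or contains
    [g] as soon as it contains [g * x].  Directly: if [g ^+ n = j + r * x] with
    [j] in [J] and [(g * x) ^+ m] is in [J], then [g ^+ (n * m + m)] is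
    congruent to [r ^+ m * (g * x) ^+ m] modulo [J]. *)
Lemma radical_split J x g : is_ideal J ->
    radical (ideal_add J (ideal_gen (eq x))) g -> radical J (g * x) ->
  radical J g.
Proof.
move=> idJ [n [j [_ [Jj [s [sx ->]] gn]]]] [m Jgx]; exists (n * m + m)%N.
have {}gn : g ^+ n = j + (\sum_(p <- s) p.1) * x.
  rewrite gn mulr_suml big_seq [in RHS]big_seq; congr (_ + _).
  by apply: eq_bigr => p /sx <-.
move: (\sum_(p <- s) p.1) gn => r gn.
have -> : g ^+ (n * m + m)
    = ((g ^+ n) ^+ m - (r * x) ^+ m) * g ^+ m + r ^+ m * (g * x) ^+ m.
  by rewrite exprD exprM mulrBl !exprMn (mulrC (g ^+ m)) mulrA subrK.
apply: idealD => //; last exact: idealMl.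
rewrite subrXX gn addrK; apply: idealMr => //; exact: idealMr.
Qed.

End IdealTheory.

Lemma ideal_preim (R S : comNzRingType) (phi : {rmorphism R -> S})
    (J : S -> Prop) : is_ideal J -> is_ideal (fun f => J (phi f)).
Proof.
move=> idJ; split=> [|f g Jf Jg|u f Jf].
- by rewrite rmorph0; apply: ideal0.
- by rewrite rmorphD; apply: idealD.
- by rewrite rmorphM; apply: idealMl.
Qed.

(** * Splitting a radical along a family of variables *)

Section VariableSplitting.
Variables (R : comNzRingType) (T : finType) (X : T -> R) (I : R -> Prop).
Hypothesis idI : is_ideal I.

Definition add_vars (A : {set T}) : R -> Prop :=
  ideal_add I (ideal_gen (fun g => exists2 a, a \in A & g = X a)).

Lemma add_vars_ideal A : is_ideal (add_vars A).
Proof. by apply: ideal_add_ideal => //; apply: ideal_gen_ideal. Qed.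

Lemma mem_add_vars A f : I f -> add_vars A f.
Proof. by apply: ideal_addl; apply: ideal_gen_ideal. Qed.

Lemma var_add_vars (A : {set T}) a : a \in A -> add_vars A (X a).
Proof. by move=> aA; apply: ideal_addr => //; apply: mem_ideal_gen; exists a. Qed.

Lemma mulXX_add_vars (A : {set T}) a b :
  (a \in A) || (b \in A) -> add_vars A (X a * X b).
Proof.
have idJ := add_vars_ideal A.
by case/orP => /var_add_vars; [apply: idealMr | apply: idealMl].
Qed.

Lemma add_vars_sub (A B : {set T}) f :
  A \subset B -> add_vars A f -> add_vars B f.
Proof.
move=> /subsetP AB; apply: (ideal_add_sub (add_vars_ideal B)) => g.
  exact: mem_add_vars.
apply: (ideal_gen_sub (add_vars_ideal B)) => _ [a /AB aB ->].
exact: var_add_vars.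
Qed.

Lemma add_vars_setU1 x A f :
  add_vars (x |: A) f -> ideal_add (add_vars A) (ideal_gen (eq (X x))) f.
Proof.
have idA := add_vars_ideal A; have idx := ideal_gen_ideal (eq (X x)).
have idJ := ideal_add_ideal idA idx.
apply: (ideal_add_sub idJ) => g.
  by move=> Ig; apply: ideal_addl => //; apply: mem_add_vars.
apply: (ideal_gen_sub idJ) => _ [a + ->].
rewrite in_setU1 => /predU1P[->|aA].
  by apply: ideal_addr => //; apply: mem_ideal_gen.
by apply: ideal_addl => //; apply: var_add_vars.
Qed.

(** The base set [C] records the variables of the branches [J + (x)] already
    taken, and the accumulated factors of [g] those of the branches [(J : x)];
    both have to be general for the induction on [s]. *)
Lemma radical_split_seq (s : seq T) (C : {set T}) (g : R) :
    (forall A : {set T}, C \subset A ->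
       radical (add_vars A) (g * \prod_(x <- s | x \notin A) X x)) ->
  radical (add_vars C) g.
Proof.
elim: s C g => [|x s IHs] C g radC.
  by have := radC C (subxx _); rewrite big_nil mulr1.
apply: (radical_split (add_vars_ideal C) (x := X x)).
  apply: (radical_sub (@add_vars_setU1 x C)); apply: IHs => A.
  rewrite subUset sub1set => /andP[xA CA].
  by have := radC A CA; rewrite big_cons xA.
apply: IHs => A CA; have := radC A CA; rewrite big_cons.
case: ifP => _; first by rewrite mulrA.
by rewrite mulrAC; apply/radicalMr/add_vars_ideal.
Qed.

Lemma radical_split_vars f :
    (forall A : {set T},
       radical (add_vars A) (f * \prod_(x | x \notin A) X x)) ->
  radical I f.
Proof.
move=> radA.
have rad0 : radical (add_vars set0) f by apply: radical_split_seq => A _.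
apply: radical_sub rad0; apply: (ideal_add_sub idI) => //.
by apply: (ideal_gen_sub idI) => g [a a0]; rewrite inE in a0.
Qed.

Lemma prod_compl_mul (A : {set T}) x y :
    x != y -> x \notin A -> y \notin A -> add_vars A (X x * X y) ->
  add_vars A (\prod_(z | z \notin A) X z).
Proof.
move=> xy xA yA Axy; rewrite (bigD1 x) //= (bigD1 y) /= ?yA 1?eq_sym //.
by rewrite mulrA; apply: idealMr Axy; apply: add_vars_ideal.
Qed.

End VariableSplitting.

(** * Join-meet ideals and admissible sets *)

Section JoinMeet.
Variables (d : Order.disp_t) (L : finLatticeType d) (K : fieldType).

Lemma join_meet_ideal_ideal : is_ideal (@join_meet_ideal K d L).
Proof. exact: ideal_gen_ideal. Qed.

(** The two variables of each monomial of a basic binomial are distinct, so a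
    monomial whose variables both avoid [A] divides the square-free product of
    the variables outside [A]. *)
Lemma prod_compl_non_admissible (A : {set L}) : ~~ admissible A ->
  add_vars (@lvar K d L) (@join_meet_ideal K d L) A
    (\prod_(a | a \notin A) lvar K a).
Proof.
case/forallPn => a /forallPn[b]; rewrite negb_imply => /andP[ab].
have idI := join_meet_ideal_ideal.
have idJ := add_vars_ideal (@lvar K d L) idI A.
have Jbin : add_vars (@lvar K d L) (@join_meet_ideal K d L) A
    (lvar K a * lvar K b - lvar K (a `&` b)%O * lvar K (a `|` b)%O).
  by apply/mem_add_vars/mem_ideal_gen; exists a, b.
have anb : a != b by apply: contraNneq ab => ->; rewrite comparablexx.
have mnj : (a `&` b)%O != (a `|` b)%O.
  apply: contraNneq ab => mj; rewrite /Order.comparable.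
  by rewrite (le_trans (leUl a b)) // -mj leIr.
case: (boolP (_ || _)) => [abA|/norP[aA bA]].
  case: (boolP (_ || _)) => // /norP[mA jA] _.
  apply: prod_compl_mul mnj mA jA _ => //.
  have Jab := mulXX_add_vars (@lvar K d L) idI abA.
  by have := idealB idJ Jab Jbin; rewrite subKr.
case: (boolP (_ || _)) => // mjA _; apply: prod_compl_mul anb aA bA _ => //.
have Jmj := mulXX_add_vars (@lvar K d L) idI mjA.
by have := idealD idJ Jbin Jmj; rewrite subrK.
Qed.

Section Admissible.
Variables (A : {set L}) (admA : admissible A).

HB.instance Definition _ := GRing.RMorphism.copy (@compl_incl K d L A admA)
  (comp_mpoly
     [tuple lvar K (compl_val (enum_val i)) | i < #|{: compl_lattice admA}|]).

Lemma compl_incl_lvar (a : compl_lattice admA) :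
  compl_incl (lvar K a) = lvar K (compl_val a).
Proof.
by rewrite /compl_incl /lvar comp_mpolyXU -tnth_nth tnth_mktuple enum_rankK.
Qed.

Lemma compl_incl_prod :
  compl_incl (\prod_(a : compl_lattice admA) lvar K a)
    = \prod_(a | a \notin A) lvar K a.
Proof.
rewrite rmorph_prod (eq_bigr _ (fun a _ => compl_incl_lvar a)).
rewrite (reindex_omap (@compl_val d L A admA) insub) => [|x xA]; last first.
  by rewrite insubT.
by apply: eq_bigl => -[x xA] /=; rewrite insubT eqxx andbT.
Qed.

Lemma compl_incl_binomial (a b : compl_lattice admA) :
  compl_incl (lvar K a * lvar K b - lvar K (a `&` b)%O * lvar K (a `|` b)%O)
    = lvar K (compl_val a) * lvar K (compl_val b)
      - lvar K (compl_val a `&` compl_val b)%O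
        * lvar K (compl_val a `|` compl_val b)%O.
Proof. by rewrite rmorphB !rmorphM /= !compl_incl_lvar. Qed.

Lemma compl_comparable (a b : compl_lattice admA) :
  (a >=< b)%O = (compl_val a >=< compl_val b)%O.
Proof. by []. Qed.

Lemma compl_incl_join_meet (f : lattice_poly K (compl_lattice admA)) :
  join_meet_ideal f -> join_meet_ideal (compl_incl f).
Proof.
apply: (ideal_gen_sub (J := fun g => join_meet_ideal (compl_incl g))).
  exact: (ideal_preim (@compl_incl K d L A admA) join_meet_ideal_ideal).
move=> _ [a [b [ab ->]]].
rewrite compl_incl_binomial; apply: mem_ideal_gen.
by exists (compl_val a), (compl_val b); rewrite -compl_comparable.
Qed.

Lemma P_ideal_ideal : is_ideal (@P_ideal K d L A admA).
Proof. by apply: ideal_add_ideal; apply: ideal_gen_ideal. Qed.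

Lemma join_meet_sub_P_ideal (f : lattice_poly K L) :
  join_meet_ideal f -> P_ideal admA f.
Proof.
have idP := P_ideal_ideal.
have idV : is_ideal (ideal_gen (fun g => exists2 a, a \in A & g = lvar K a)).
  exact: ideal_gen_ideal.
have idE := ideal_gen_ideal (fun g => exists2 f,
  ideal_colon (join_meet_ideal (L := compl_lattice admA))
    (\prod_(a : compl_lattice admA) lvar K a) f & g = compl_incl f).
apply: (ideal_gen_sub idP) => _ [a [b [ab ->]]].
have /forallP/(_ a)/forallP/(_ b)/implyP/(_ ab)/eqP admab := admA.
have PXX x y : (x \in A) || (y \in A) -> P_ideal admA (lvar K x * lvar K y).
  have PX z : z \in A -> P_ideal admA (lvar K z).
    by move=> zA; apply: ideal_addr idE _; apply: mem_ideal_gen; exists z.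
  by case/orP => /PX; [apply: idealMr | apply: idealMl].
case: (boolP ((a \in A) || (b \in A))) => [abA|/norP[aA bA]].
  by apply: idealB => //; apply: PXX => //; rewrite -admab.
pose a' : compl_lattice admA := ComplLattice (admA := admA) aA.
pose b' : compl_lattice admA := ComplLattice (admA := admA) bA.
apply: ideal_addl idV _; apply: mem_ideal_gen.
exists (lvar K a' * lvar K b' - lvar K (a' `&` b')%O * lvar K (a' `|` b')%O).
  apply: idealMr; first exact: ideal_gen_ideal.
  by apply: mem_ideal_gen; exists a', b'; rewrite compl_comparable.
by rewrite compl_incl_binomial.
Qed.

(** Multiplying by the product of the variables outside [A] undoes the colon,
    and the join-meet ideal of the sublattice is carried into that of [L]. *)
Lemma P_ideal_mul_prod (f : lattice_poly K L) : P_ideal admA f ->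
  add_vars (@lvar K d L) (@join_meet_ideal K d L) A
    (f * \prod_(a | a \notin A) lvar K a).
Proof.
have idJ := add_vars_ideal (@lvar K d L) join_meet_ideal_ideal A.
have idC := ideal_colon_ideal (\prod_(a | a \notin A) lvar K a) idJ.
apply: (ideal_add_sub idC) => [g|g Ag].
  apply: (ideal_gen_sub idC) => _ [h colh ->]; rewrite /ideal_colon.
  rewrite -compl_incl_prod -rmorphM.
  by apply: mem_add_vars; apply: compl_incl_join_meet.
by apply: idealMr => //; apply: ideal_addr => //; apply: join_meet_ideal_ideal.
Qed.

End Admissible.
End JoinMeet.

Theorem theorem2p6 (d : Order.disp_t) (L : finLatticeType d) (K : fieldType)
    (radI : radical_ideal (@join_meet_ideal K d L)) :
  forall f : lattice_poly K L,
    join_meet_ideal f <->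
    (forall (A : {set L}) (admA : admissible A), P_ideal admA f).
Proof.
move=> f; split=> [If A admA|Pf]; first exact: join_meet_sub_P_ideal.
have idI := @join_meet_ideal_ideal d L K.
apply/radI; apply: (radical_split_vars (X := @lvar K d L) idI) => A.
apply: mem_radical.
have [admA|nadmA] := boolP (admissible A).
  exact: P_ideal_mul_prod (Pf A admA).
by apply: idealMl; [apply: add_vars_ideal | apply: prod_compl_non_admissible].
Qed.
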